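(* (1) There is a scattered space $X$ of countable scattered height such that the nabla product $\nabla X^\omega$ is not a $D$-space. (2) There is a sequence $(X_n)_{n\in\omega}$ of spaces, where each $X_n$ is scattered of scattered height $n$, such that the nabla product $\nabla_n X_n$ is not a $D$-space.
   Context: For a space $X$ let $\mathrm{I}(X)$ be its set of isolated points. Put $X^{(0)}=X$, $X^{(\alpha+1)}=X^{(\alpha)}\setminus \mathrm{I}(X^{(\alpha)})$, and $X^{(\lambda)}=\bigcap_{\alpha<\lambda}X^{(\alpha)}$ for limit $\lambda$. $X$ is scattered if every nonempty subspace has an isolated point (equivalently, some $X^{(\alpha)}=\emptyset$), and then its scattered height is $\mathrm{ht}(X)=\sup\{\alpha: X^{(\alpha)}\neq\emptyset\}$. A neighbornet on a space $(X,\tau)$ is a map $U:X\to\tau$ with $x\in U(x)$ for all $x\in X$. $X$ is a $D$-space if for every neighbornet $U$ on $X$ there is a closed discrete $D\subseteq X$ with $\bigcup_{x\in D}U(x)=X$. The box product $\square_n X_n$ is the set $\prod_n X_n$ with the topology generated by all sets $\prod_n U_n$ with every $U_n$ open in $X_n$. The nabla product $\nabla_n X_n$ is the quotient space $(\square_n X_n)/{=^*}$, where $x=^*y$ iff $x(n)=y(n)$ for all but finitely many $n$. $\nabla X^\omega$ is $\nabla_n X_n$ with $X_n=X$ for all $n\in\omega$. *)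

(* Defs.v *)
From HB Require Import structures.
From mathcomp Require Import all_boot all_order all_algebra.
From mathcomp Require Import finmap all_classical topology.

Set Implicit Arguments.
Unset Strict Implicit.
Unset Printing Implicit Defensive.

Local Open Scope classical_set_scope.

(** Ordinals are represented by trees built from zero, successors and suprema
    of arbitrary small families. Each ordnum has many representations;
    equality of ordinals is [ord_eq], not [=]. *)
Inductive ordnum : Type :=
| ord_zero : ordnum
| ord_succ : ordnum -> ordnum
| ord_sup : forall K : Type, (K -> ordnum) -> ordnum.

(* The inner fixpoint is a' < b, as a function of b. *)
Fixpoint ord_le (a : ordnum) : ordnum -> Prop :=
  match a with
  | ord_zero => fun _ => True
  | ord_succ a' =>
      fix lt_a' (b : ordnum) : Prop :=
        match b with
        | ord_zero => False
        | ord_succ b' => ord_le a' b'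
        | ord_sup J g => exists j : J, lt_a' (g j)
        end
  | ord_sup K f => fun b => forall i : K, ord_le (f i) b
  end.

Definition ord_lt (a b : ordnum) : Prop := ord_le (ord_succ a) b.

Definition ord_eq (a b : ordnum) : Prop := ord_le a b /\ ord_le b a.

Fixpoint ord_nat (n : nat) : ordnum :=
  if n is m.+1 then ord_succ (ord_nat m) else ord_zero.

(* Countably many predecessors, up to equality of ordinals. *)
Definition countable_ordinal (a : ordnum) : Prop :=
  exists f : nat -> ordnum,
    forall b, ord_lt b a -> exists n, ord_eq b (f n).

Definition ord_is_sup (S : ordnum -> Prop) (a : ordnum) : Prop :=
  (forall b, S b -> ord_le b a) /\
  (forall c, (forall b, S b -> ord_le b c) -> ord_le a c).

Section Scattered.
Variable X : topologicalType.

(* [ord_sup] also represents suprema that are not limits; the intersection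
   clause is still right there because the derivatives decrease, so that
   [derived a] depends only on the ordnum represented by [a]: see
   [derived_le]. *)
Fixpoint derived (a : ordnum) : set X :=
  match a with
  | ord_zero => setT
  | ord_succ b => derived b `\` isolated (derived b)
  | ord_sup K f => \bigcap_(i in [set: K]) derived (f i)
  end.

Lemma derived_le (a b : ordnum) : ord_le a b -> derived b `<=` derived a.
Proof.
elim: a b => [b _ x //|a IH|I f IH b /= fb x xb i _]; last exact: IH (fb i) _ xb.
elim=> [//|b _|J g IHg] /=.
  move=> /IH sba x [bx nix]; split; first exact: sba.
  move=> [_ [V Vx VE]]; apply: nix; split; first exact/mem_set.
  exists V => //; apply/seteqP; split=> [y [Vy yb]|y ->].
    by rewrite -VE; split=> //; exact: sba.
  by split=> //; exact: nbhs_singleton.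
by move=> [j /IHg sj] x xg; apply: sj; exact: xg.
Qed.

Lemma derived_eq (a b : ordnum) : ord_eq a b -> derived a = derived b.
Proof. by move=> [ab ba]; apply/seteqP; split; exact: derived_le. Qed.

Definition scattered : Prop :=
  forall A : set X, A !=set0 -> isolated A !=set0.

Definition scattered_height (a : ordnum) : Prop :=
  ord_is_sup (fun b => derived b !=set0) a.

Definition countable_scattered_height : Prop :=
  exists2 a, scattered_height a & countable_ordinal a.

Definition neighbornet (U : X -> set X) : Prop :=
  forall x, open (U x) /\ U x x.

(* Discrete in the subspace topology: every point of D is isolated in D. *)
Definition discrete_subset (D : set X) : Prop := D `<=` isolated D.

(* No separation axiom is assumed. *)
Definition D_space : Prop :=
  forall U : X -> set X, neighbornet U ->
    exists D : set X,
      [/\ closed D, discrete_subset D & \bigcup_(x in D) U x = setT].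

End Scattered.

Definition box_product (X : nat -> topologicalType) : Type := forall n, X n.

Section BoxProduct.
Variable X : nat -> topologicalType.

HB.instance Definition _ := gen_eqMixin (box_product X).
HB.instance Definition _ := gen_choiceMixin (box_product X).

Definition box (U : forall n, set (X n)) : set (box_product X) :=
  [set x | forall n, U n (x n)].

Definition open_boxes : set_system (box_product X) :=
  [set B | exists2 U : forall n, set (X n), (forall n, open (U n)) & B = box U].

HB.instance Definition _ :=
  isSubBaseTopological.Build (box_product X) open_boxes id.

Lemma open_box (U : forall n, set (X n)) :
  (forall n, open (U n)) -> open (box U).
Proof.
move=> oU; exists [set box U]; last by rewrite bigcup_set1.
move=> _ ->; apply: finI_from1; by exists U.
Qed.

Lemma box_finI (B : set (box_product X)) : finI_from open_boxes id B ->
  forall x, B x -> exists U : forall n, set (X n),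
    [/\ forall n, open (U n), box U x & box U `<=` B].
Proof.
move=> [F sF FB] x Bx.
suff [U [oU Ux UF]] : exists U : forall n, set (X n),
    [/\ forall n, open (U n), box U x &
        forall C, C \in enum_fset F -> box U `<=` C].
  by exists U; split=> // y Uy; rewrite -FB => C CF; exact: UF Uy.
have: forall C, C \in enum_fset F -> C x /\ open_boxes C.
  move=> C CF; split; last exact/set_mem/sF.
  by move: Bx; rewrite -FB; exact.
elim: (enum_fset F) => [_|C s IH h].
  by exists (fun=> setT); split=> // n; exact: openT.
have [|U [oU Ux Us]] := IH; first by move=> E Es; apply: h; rewrite inE Es orbT.
have [Cx [V oV CV]] := h C (mem_head _ _).
exists (fun n => U n `&` V n); split=> [n|n|E]; first exact: openI.
  by split; [exact: Ux|move: Cx; rewrite CV; exact].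
rewrite inE => /orP[/eqP ->|/Us sE] y Uy.
  by rewrite CV => n; case: (Uy n).
by apply: sE => n; case: (Uy n).
Qed.

Lemma box_openP (A : set (box_product X)) :
  open A <-> forall x, A x -> exists U : forall n, set (X n),
    [/\ forall n, open (U n), box U x & box U `<=` A].
Proof.
split; last first.
  move=> h; rewrite openE => x /h [U [oU Ux UA]].
  by rewrite /interior nbhsE; exists (box U) => //; split=> //; exact: open_box.
move=> [D' sD <-] x [B D'B Bx].
have [U [oU Ux UB]] := box_finI (sD _ D'B) Bx.
by exists U; split=> // y /UB By; exists B.
Qed.

Definition mod_finite (x y : box_product X) : bool :=
  `[< finite_set [set n | x n <> y n] >].

Lemma mod_finite_refl : reflexive mod_finite.
Proof.
move=> x; apply/asboolP; rewrite (_ : [set n | _] = set0) //.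
by apply/seteqP; split.
Qed.

Lemma mod_finite_sym : symmetric mod_finite.
Proof.
move=> x y; congr (`[< finite_set _ >]).
by apply/seteqP; split=> n /= h /esym.
Qed.

Lemma mod_finite_trans : transitive mod_finite.
Proof.
move=> y x z /asboolP xy /asboolP yz; apply/asboolP.
apply: (sub_finite_set _ (_ : finite_set
  ([set n | x n <> y n] `|` [set n | y n <> z n]))); last by rewrite finite_setU.
move=> n /= xz; have [e|] := pselect (x n = y n); last by left.
by right; rewrite -e.
Qed.

Canonical mod_finite_equiv :=
  EquivRel mod_finite mod_finite_refl mod_finite_sym mod_finite_trans.

End BoxProduct.

Definition nabla_product (X : nat -> topologicalType) : topologicalType :=
  quotient_topology {eq_quot mod_finite_equiv X}%qT.

(* Main.v *)
Require Import Defs.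
From HB Require Import structures.
From mathcomp Require Import all_boot all_order all_algebra.
From mathcomp Require Import finmap all_classical topology.

(** Both spaces come from one linear order [O]. Define index types of
    increasing size by letting the first be [nat] and the next consist of the
    well-founded trees branching over the previous one ([towers]); say that a
    point [a] of [O] has class [n] if every family below [a] indexed by the
    [n]-th type is strictly bounded below [a], but some family indexed by the
    next type is not ([cof_class]). This imitates the ordinals of cofinality
    [omega_(n+1)], and classes are disjoint. If every family indexed by one of
    these types is bounded in [O] and has a least upper bound, then every
    unbounded subset of [O] has limits of every class: climb through the set
    along a tree and take the supremum ([cof_class_limit]).

    Take the points of the classes in [P] as a space ([layers]), a point [x] of
    class [n] having as neighborhoods the sets that contain [x] and all points
    of smaller class in some interval below [x]. A point is isolated in a set
    as soon as its class is minimal there, so the space is scattered; a point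
    of class [n] is a limit of points of each smaller class, so the derivatives
    peel off one class at a time ([derived_layers]). All classes together give
    height [omega], the classes up to [n] give height [n].

    In a nabla product of such spaces in which each class is eventually
    present, consider the set of sequences that are eventually constant as
    points of [O]. It is closed, since disjoint intervals separate
    any two points of [O] ([closed_diagonal]). Let the neighborhood assigned to
    the sequence constantly [a] consist of the sequences eventually at most
    [a], and let all other points avoid the eventually constant sequences.
    Let [D] be closed and discrete. The constants of class [n] in [D] are
    bounded in [O], for otherwise they have a limit [b] of class [n+1]; the
    countably many intervals below [b] given by a neighborhood of the sequence
    constantly [b] contain a common interval, because countable families below
    [b] are bounded below [b], so this sequence is a limit point of [D]
    ([trace_limit_point]). Countable families being bounded in [O], all
    constants in [D] lie below one point of [O], and a constant
    above that point is not covered. *)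

Set Implicit Arguments.
Unset Strict Implicit.
Unset Printing Implicit Defensive.

Import Order.TTheory.
Local Open Scope classical_set_scope.
Local Open Scope order_scope.
Local Open Scope quotient_scope.

(** * Scattered heights [n] and [omega] *)

Lemma ord_le_total (a b : ordnum) : ord_le a b \/ ord_lt b a.
Proof.
elim: a b => [b|a IH|K f IH b]; first by left.
  elim=> [|b _|K g IHg]; first by right.
    exact: IH.
  have [[j]|h] := pselect (exists j, ord_lt a (g j)); first by left; exists j.
  by right => j; have [h'|//] := IHg j; case: h; exists j.
have [h|/existsNP[i h]] := pselect (forall i, ord_le (f i) b); first by left.
by right; exists i; have [] := IH i b.
Qed.

Definition ord_omega : ordnum := ord_sup ord_nat.

Lemma countable_ord_omega : countable_ordinal ord_omega.
Proof.
exists ord_nat => b [j]; elim: j => [//|j IH] bj.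
have [jb|] := ord_le_total (ord_nat j) b; last exact: IH.
by exists j; split.
Qed.

Lemma scattered_height_nat (X : topologicalType) (n : nat) :
  derived (X := X) (ord_nat n) !=set0 -> derived (X := X) (ord_nat n.+1) = set0 ->
  scattered_height X (ord_nat n).
Proof.
move=> Xn XSn; split=> [b [x bx]|c]; last exact.
have [//|/derived_le/(_ _ bx)] := ord_le_total b (ord_nat n).
by rewrite -/(ord_nat n.+1) XSn.
Qed.

Lemma scattered_height_omega (X : topologicalType) :
  (forall n, derived (X := X) (ord_nat n) !=set0) ->
  \bigcap_n derived (X := X) (ord_nat n) = set0 -> scattered_height X ord_omega.
Proof.
move=> Xn Xw; split=> [b [x bx]|c cub n]; last exact: cub.
have [//|/derived_le/(_ _ bx)[xw _]] := ord_le_total b ord_omega.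
suff : set0 x by [].
by rewrite -Xw.
Qed.

(** * A linear order in which small families are bounded and have suprema *)

(** The set of all subsets of [seq I] cannot be enumerated by [seq I], while
    [seq I] enumerates any [I]-indexed union of sets that it enumerates. So for
    inhabited [I] the small sets form a proper ideal closed under [I]-indexed
    unions. *)
Definition small (I : Type) (A : set (set (seq I))) : Prop :=
  exists g : seq I -> set (seq I), A `<=` range g.

Lemma not_smallT (I : Type) : ~ small [set: set (seq I)].
Proof.
move=> [g gT]; have [s _ gs] := gT [set s | ~ g s s] Logic.I.
have [gN Ng] : g s s <-> ~ g s s by rewrite {1}gs.
by have ngs : ~ g s s; [move=> h; exact: (gN h h)|exact/ngs/Ng].
Qed.

Lemma small_bigcup (I : Type) (F : I -> set (set (seq I))) :
  (forall i, small (F i)) -> small (\bigcup_i F i).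
Proof.
move=> /choice[g gF].
exists (fun s => if s is i :: t then g i t else set0) => A [i _ /gF[t _ <-]].
by exists (i :: t).
Qed.

Lemma small_setU1 (I : Type) (i : I) (a : set (seq I)) A :
  small A -> small (a |` A).
Proof.
move=> [g gA]; exists (fun s => if s is _ :: t then g t else a).
by move=> _ [->|/gA[t _ <-]]; [exists [::]|exists (i :: t)].
Qed.

Definition small_chain (I : Type) (C : set (set (set (seq I)))) : Prop :=
  C `<=` @small I /\ total_on C subset.

(** Zorn's lemma. Maximality is used in this form: a small set comparable with
    the whole chain is in it. *)
Lemma maximal_small_chain (I : Type) : exists C : set (set (set (seq I))),
  small_chain C /\ forall A, small A ->
    (forall B, C B -> A `<=` B \/ B `<=` A) -> C A.
Proof.
have [|C [chC maxC]] := @Zorn_bigcup _ (@small_chain I).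
  move=> F FP totF; split=> [A [C /FP[+ _]]|]; first exact.
  move=> A B [C FC CA] [D FD DB].
  have [CD|DC] := totF _ _ FC FD.
    by have [_ +] := FP _ FD; apply=> //; exact: CD.
  by have [_ +] := FP _ FC; apply=> //; exact: DC.
exists C; split=> // A sA cmpA; apply: contrapT => nCA.
apply: (maxC (A |` C)).
  by split=> [B CB|/(_ A (or_introl erefl))//]; right.
have [sC totC] := chC; split=> [B [->//|/sC//]|B D].
move=> [->|CB] [->|CD]; [by left|exact: cmpA| |exact: totC].
by have [] := cmpA B CB; [right|left].
Qed.

(** A maximal chain of small sets, ordered by inclusion. The union of a family
    from the chain is comparable with every member, hence is its supremum in
    the chain. There is no largest member, since a point could be added to
    it; so families are even strictly bounded. *)
Lemma wide_order (I : Type) (i0 : I) :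
  exists O : orderType (Order.Disp tt tt),
    [/\ inhabited O, (forall f : I -> O, exists b, forall i, f i < b) &
    (forall f : I -> O, exists b, (forall i, f i <= b) /\
       forall c, (forall i, f i <= c) -> b <= c)].
Proof.
have [C [[sC totC] maxC]] := maximal_small_chain I.
pose T := {A | C A}.
pose le (x y : T) := `[< sval x `<=` sval y >].
pose eqT := gen_eqMixin T.
pose T1 : choiceType := HB.pack T eqT (gen_choiceMixin T).
pose lt (x y : T1) := (y != x) && le x y.
pose mt (x y : T1) := if lt x y then x else y.
pose jn (x y : T1) := if lt x y then y else x.
have anti : antisymmetric (le : rel T1).
  move=> [A CA] [B CB] /andP[/asboolP/= AB /asboolP/= BA].
  exact/eq_exist/seteqP.
have tr : transitive (le : rel T1).
  move=> y x z /asboolP xy /asboolP yz; apply/asboolP; exact: subset_trans yz.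
have tot : total (le : rel T1).
  move=> x y; apply/orP.
  by have [|] := totC _ _ (svalP x) (svalP y);
    [left|right]; apply/asboolP.
pose ordm := Order.isOrder.Build (Order.Disp tt tt) T1 (fun _ _ => erefl)
  (fun _ _ => erefl : mt _ _ = _) (fun _ _ => erefl : jn _ _ = _) anti tr tot.
pose O : orderType (Order.Disp tt tt) := HB.pack T1 ordm.
have leE (x y : O) : (x <= y) = `[< sval x `<=` sval y >] by [].
have lub (f : I -> O) : exists b : O,
    [/\ sval b = \bigcup_i sval (f i), forall i, f i <= b &
     forall c, (forall i, f i <= c) -> b <= c].
  have Cf : C (\bigcup_i sval (f i)).
    apply: maxC => [|B CB]; first by apply: small_bigcup => i; apply/sC/svalP.
    have [h|/existsNP[i h]] := pselect (forall i, sval (f i) `<=` B).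
      by left => A [i _]; exact: h.
    right; have [//|BA] := totC _ _ (svalP (f i)) CB.
    by move=> A /BA; exists i.
  exists (exist _ _ Cf : O); split=> // [i|c fc].
    by rewrite leE; apply/asboolP => A; exists i.
  by rewrite leE; apply/asboolP => A [i _]; move: (fc i); rewrite leE => /asboolP; exact.
exists O; split=> [|f|f]; last by have [b [_ ? ?]] := lub f; exists b.
  have C0 : C set0 by apply: maxC => [|B _]; [exists (fun=> set0)|left].
  exact: inhabits (exist _ set0 C0).
have [b [bE fb _]] := lub f.
suff [c bc] : exists c : O, b < c.
  by exists c => i; exact: le_lt_trans (fb i) bc.
apply: contrapT => nc.
have maxb (c : O) : c <= b by rewrite leNgt; apply/negP => bc; apply: nc; exists c.
have [a ba] : exists a, ~ sval b a.
  apply/existsNP => bT; apply: (@not_smallT I).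
  have <- : sval b = setT by apply/seteqP; split=> // a _; exact: bT.
  exact/sC/svalP.
have Ca : C (a |` sval b).
  apply: maxC => [|B CB]; first by apply: (small_setU1 i0); apply/sC/svalP.
  right => A BA; right; move: (maxb (exist _ _ CB : O)).
  by rewrite leE => /asboolP; exact.
have := maxb (exist _ _ Ca : O); rewrite leE => /asboolP/=.
by move=> /(_ a (or_introl erefl)).
Qed.

(** * Neighborhoods in nabla products *)

Section Nabla.
Variable X : nat -> topologicalType.
Local Notation nabla := (nabla_product X).

Lemma eq_cofinite (f g : box_product X) :
  finite_set [set n | f n <> g n] <-> exists N, forall n, (N <= n)%N -> f n = g n.
Proof.
split=> [/finite_fsetP[F FE]|[N fg]].
  exists (\max_(i <- enum_fset F) i).+1 => n nF; apply: contrapT => fgn.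
  have : [set` F] n by rewrite -FE.
  move=> nF'; have := @leq_bigmax_seq _ (enum_fset F) predT (fun i => i) n nF' isT.
  by move=> /(leq_trans nF); rewrite ltnn.
apply: (sub_finite_set _ (finite_II N)) => n /= fgn.
by rewrite ltnNge; apply/negP => /fg.
Qed.

Lemma pi_nabla (f g : box_product X) :
  (exists N, forall n, (N <= n)%N -> f n = g n) <-> \pi_nabla f = \pi_nabla g.
Proof.
rewrite -eq_cofinite; split=> [fg|/eqP].
  by apply/eqmodP; apply/asboolP.
by move=> /eqP/eqmodP/asboolP.
Qed.

Lemma repr_nabla (f : box_product X) :
  exists N, forall n, (N <= n)%N -> repr (\pi_nabla f) n = f n.
Proof. by apply/pi_nabla; rewrite reprK. Qed.

(** If no [W n] is empty, this is the image of the box: classes forget finitely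
    many coordinates, and [repr] only serves to name a sequence of the class. *)
Definition nabla_box (W : forall n, set (X n)) : set nabla :=
  [set q | exists N, forall n, (N <= n)%N -> W n (repr q n)].

Lemma nabla_box_pi (W : forall n, set (X n)) (f : box_product X) :
  nabla_box W (\pi_nabla f) <-> exists N, forall n, (N <= n)%N -> W n (f n).
Proof.
have [M fE] := repr_nabla f.
by split=> -[N WN]; exists (maxn M N) => n; rewrite geq_max => /andP[/fE e /WN];
  rewrite e.
Qed.

Lemma open_nabla_box (W : forall n, set (X n)) :
  (forall n, open (W n)) -> open (nabla_box W).
Proof.
move=> oW; apply/box_openP => f /nabla_box_pi[N WN].
exists (fun n => if (N <= n)%N then W n else setT); split=> [n|n|g Wg].
- by case: ifP => _; [exact: oW|exact: openT].
- by case: ifP => [/WN|].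
- by apply/nabla_box_pi; exists N => n Nn; have := Wg n; rewrite Nn.
Qed.

Lemma nbhs_nabla_box (f : box_product X) (A : set nabla) :
  nbhs (\pi_nabla f : nabla) A -> exists W : forall n, set (X n),
    [/\ forall n, open (W n), forall n, W n (f n) & nabla_box W `<=` A].
Proof.
rewrite nbhsE => -[B [oB Bf] BA].
have /box_openP/(_ f Bf)[W [oW Wf WB]] : open (\pi_nabla @^-1` B) by exact: oB.
exists W; split=> // q [N Wq]; apply: BA.
pose g : box_product X := fun n => if (N <= n)%N then repr q n else f n.
have -> : q = \pi_nabla g.
  rewrite -{1}(reprK q); apply/pi_nabla; exists N => n Nn.
  by rewrite /g Nn.
by apply: WB => n; rewrite /g; case: ifP => [/Wq|].
Qed.
End Nabla.

(** * Cofinality classes *)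

(** Trees are the index type of the climbs in [cof_class_limit]: any family of
    trees indexed by [I] has a tree, its [node], that comes after all of them.
    The labels of the leaves let a family over [I] be read as one over trees,
    see [directed_leaf]. *)
Inductive tree (I : Type) : Type :=
| leaf : I -> tree I
| node : (I -> tree I) -> tree I.

Fixpoint towers (n : nat) : Type := if n is m.+1 then tree (towers m) else nat.

Fixpoint towers0 (n : nat) : towers n :=
  if n is m.+1 then leaf (towers0 m) else 0%N.

Section LongOrder.
Context {disp : Order.disp_t} (O : orderType disp).

Definition directed (I : Type) (D : set O) : Prop :=
  forall f : I -> O, (forall i, D (f i)) ->
    exists2 b, D b & forall i, f i < b.

Definition below (a : O) : set O := [set b | b < a].

(** The analogue of having cofinality [omega_(n+1)]. *)
Definition cof_class (n : nat) (a : O) : Prop :=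
  directed (towers n) (below a) /\ ~ directed (towers n.+1) (below a).

Lemma directed_leaf (I : Type) (i0 : I) D :
  directed (tree I) D -> directed I D.
Proof.
move=> cD f fD.
have [|b Db fb] := cD (fun w => if w is leaf i then f i else f i0).
  by case.
by exists b => // i; exact: (fb (leaf i)).
Qed.

Lemma directed_le m n D : (m <= n)%N ->
  directed (towers n) D -> directed (towers m) D.
Proof.
move=> /subnK<-; elim: (n - m)%N => // k IH cD.
exact/IH/(directed_leaf (towers0 _))/cD.
Qed.

Lemma cof_class_inj m n a : cof_class m a -> cof_class n a -> m = n.
Proof.
wlog mn : m n / (m <= n)%N => [h|[_ nm] [cn _]].
  by have /orP[|] := leq_total m n => [/h|/h +]; [exact|move=> h' ? ?; exact/esym/h'].
apply/eqP; rewrite eqn_leq mn leqNgt; apply/negP => lt_mn.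
exact/nm/(directed_le lt_mn).
Qed.

Variable o0 : O.
Hypothesis bounded : forall n, directed (towers n) setT.
Hypothesis lub : forall n (f : towers n -> O), exists b, (forall i, f i <= b) /\
  forall c, (forall i, f i <= c) -> b <= c.

(** Climb in [D] along trees: a leaf stays at the start, a node is sent above
    the images of its children. The supremum [b] of the climb is not attained.
    A family over [towers n] below [b] is dominated by images of trees, and the
    node over these trees bounds it below [b]; but the climb itself, a family
    over [towers n.+1], is cofinal in [b]. *)
Lemma cof_class_limit n (D : set O) : D !=set0 -> directed (towers n) D ->
  exists b (d : towers n.+1 -> O),
    [/\ cof_class n b, forall w, D (d w) /\ d w < b &
        forall c, c < b -> exists w, c < d w].
Proof.
move=> [d0 Dd0] cD.
have /choice[bnd bndP] : forall f : towers n -> O, exists b,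
    (forall i, D (f i)) -> D b /\ forall i, f i < b.
  move=> f; have [/cD[b Db fb]|nf] := pselect (forall i, D (f i)).
    by exists b.
  by exists d0.
pose d := fix d (w : tree (towers n)) : O :=
  if w is node f then bnd (fun i => d (f i)) else d0.
have Dd w : D (d w) by elim: w => [//|f IH] /=; have [] := bndP _ IH.
have dnode f i : d (f i) < d (node f).
  by have [_ +] := bndP _ (fun i => Dd (f i)); exact.
have [b [db lubb]] := @lub n.+1 d.
have dltb w : d w < b.
  exact: lt_le_trans (dnode (fun=> w) (towers0 n)) (db (node (fun=> w))).
have cofd c : c < b -> exists w, c < d w.
  move=> cb; apply: contrapT => /forallNP h; move: cb.
  rewrite ltNge => /negP; apply; apply: lubb => w.
  by rewrite leNgt; apply/negP; exact: h.
exists b, d; split=> //; split=> [f fb|cb].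
  have /choice[w fw] : forall i, exists w, f i < d w by move=> i; exact: cofd (fb i).
  exists (d (node w)) => [|i]; first exact: dltb.
  exact: lt_trans (fw i) (dnode w i).
have [c cltb dc] := cb d dltb; have [w cw] := cofd c cltb.
by have := lt_trans cw (dc w); rewrite ltxx.
Qed.

(** The interval from [c] to [a] is as directed as the points below [a], so
    there is a climb in it. The climb is indexed by [towers m.+1], hence strictly
    bounded below [a], and its supremum is less than [a]. *)
Lemma cof_class_between m n a c : cof_class n a -> (m < n)%N -> c < a ->
  exists b, [/\ cof_class m b, c < b & b < a].
Proof.
move=> [ca _] mn lt_ca.
pose D := [set b | c < b < a].
have cD i : (i <= n)%N -> directed (towers i) D.
  move=> /directed_le/(_ ca) ci f fD.
  have [j|b ba fb] := ci f; first by have /andP[] := fD j.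
  exists b => //; apply/andP; split=> //; apply: lt_trans (fb (towers0 i)).
  by have /andP[] := fD (towers0 i).
have [|b [d [clb dD cofd]]] := @cof_class_limit m D _ (cD _ (ltnW mn)).
  have [//|b ba cb] := ca (fun=> c).
  by exists b; apply/andP; split=> //; exact: (cb (towers0 n)).
exists b; split=> //.
  have [/andP[cd _] db] := dD (towers0 m.+1); exact: lt_trans cd db.
have [|e ea de] := directed_le mn ca (f := d).
  by move=> w; have [/andP[]] := dD w.
apply: le_lt_trans ea; rewrite leNgt; apply/negP => /cofd[w /lt_trans/(_ (de w))].
by rewrite ltxx.
Qed.


Lemma cof_class_unbounded n c : exists b, c < b /\ cof_class n b.
Proof.
have cD : directed (towers n) [set b | c < b].
  move=> f fc; have [//|b _ fb] := bounded (f := f).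
  by exists b => //; exact: lt_trans (fc (towers0 n)) (fb (towers0 n)).
have [|b [d [clb dD _]]] := cof_class_limit _ cD.
  by have [//|b _ cb] := bounded (n := 0) (f := fun=> c); exists b; exact: (cb 0%N).
by exists b; split=> //; have [cd db] := dD (towers0 n.+1); exact: lt_trans cd db.
Qed.

(** * Layered spaces *)

Definition layers (P : set nat) : Type :=
  {a : O | exists2 n, P n & cof_class n a}.

Section Layers.
Variable P : set nat.

HB.instance Definition _ := gen_eqMixin (layers P).
HB.instance Definition _ := gen_choiceMixin (layers P).

Definition layer (x : layers P) : nat := projT1 (cid2 (svalP x)).

Lemma layerP x : P (layer x) /\ cof_class (layer x) (sval x).
Proof. by rewrite /layer; case: cid2. Qed.

Definition layers_open (W : set (layers P)) : Prop :=
  forall x, W x -> (0 < layer x)%N -> exists2 c, c < sval x &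
    forall y, c < sval y < sval x -> (layer y < layer x)%N -> W y.


(** The content is that every point of the space has a point of [O] below it:
    otherwise every family below it would be vacuously bounded, and it would
    have no class. *)
Lemma layers_openT : layers_open setT.
Proof.
move=> x _ _; have [_ [_ ncx]] := layerP x.
apply: contrapT => nbelow; apply: ncx => f fx.
by case: nbelow; exists (f (towers0 (layer x).+1)) => //; exact: fx.
Qed.

Lemma layers_openI : setI_closed layers_open.
Proof.
move=> V W oV oW x [Vx Wx] x_gt0.
have [b bx bV] := oV x Vx x_gt0; have [c cx cW] := oW x Wx x_gt0.
exists (Order.max b c); first by rewrite gt_max bx.
move=> y; rewrite gt_max => /andP[/andP[lt_by lt_cy] yx] lyx.
by split; [apply: bV|apply: cW]; rewrite ?lt_by ?lt_cy.
Qed.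

Lemma layers_open_bigcup (I : Type) (W : I -> set (layers P)) :
  (forall i, layers_open (W i)) -> layers_open (\bigcup_i W i).
Proof.
move=> oW x [i _ Wx] x_gt0; have [c cx cW] := oW i x Wx x_gt0.
by exists c => // y cyx lyx; exists i => //; exact: cW.
Qed.

HB.instance Definition _ := isOpenTopological.Build (layers P)
  layers_openT layers_openI layers_open_bigcup.


Lemma open_layersE (W : set (layers P)) : open W = layers_open W.
Proof. by []. Qed.

Lemma open_layers_down (W : set (layers P)) :
  (forall x y, W x -> sval y < sval x -> W y) -> open W.
Proof.
rewrite open_layersE => Wdown x Wx x_gt0; have [c cx _] := layers_openT (x := x) Logic.I x_gt0.
by exists c => // y /andP[_ yx] _; exact: Wdown yx.
Qed.

Definition layer_nbhs (x : layers P) : set (layers P) :=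
  [set y | y = x \/ (layer y < layer x)%N].

Lemma open_layer_nbhs x : open (layer_nbhs x).
Proof.
rewrite open_layersE => y xy y_gt0; have [c cy _] := layers_openT (x := y) Logic.I y_gt0.
exists c => // z _ lzy; right.
by case: xy lzy => [->//|/[swap]]; exact: ltn_trans.
Qed.

Lemma isolated_minimal_layer (A : set (layers P)) x : A x ->
  (forall y, A y -> (layer x <= layer y)%N) -> isolated A x.
Proof.
move=> Ax minx; split; first exact: mem_set.
exists (layer_nbhs x).
  by apply: open_nbhs_nbhs; split; [exact: open_layer_nbhs|left].
apply/seteqP; split=> [y [[//|lyx] Ay]|_ ->]; last by split; [left|].
by have := minx y Ay; rewrite leqNgt lyx.
Qed.

Lemma layers_scattered : scattered (layers P).
Proof.
move=> A [x Ax].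
have exA : exists n, `[< exists2 x, A x & layer x = n >].
  by exists (layer x); apply/asboolP; exists x.
case: (ex_minnP exA) => n /asboolP[y Ay <-] miny.
exists y; apply: isolated_minimal_layer => // z Az.
by apply: miny; apply/asboolP; exists z.
Qed.

Lemma layers_mem n (a : O) : P n -> cof_class n a ->
  exists2 x : layers P, sval x = a & layer x = n.
Proof.
move=> Pn na; have Pa : exists2 n, P n & cof_class n a by exists n.
exists (exist _ a Pa) => //.
by have [_] := layerP (exist _ a Pa); move/cof_class_inj; apply.
Qed.

Hypothesis Pdown : forall m n, (m <= n)%N -> P n -> P m.

(** Points of the lowest remaining class [n] are isolated. A point of larger
    class is not: by [cof_class_between] every interval below it has points of
    class [n], which are in the space as [P] is closed downwards. *)
Lemma derived_layers n :
  derived (ord_nat n) = [set x : layers P | (n <= layer x)%N].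
Proof.
elim: n => [|n IH] /=; first by apply/seteqP; split.
rewrite IH; apply/seteqP; split=> [x [/= nx nix]|x nx] /=.
  rewrite ltn_neqAle nx andbT; apply/eqP => nE; apply: nix.
  by apply: isolated_minimal_layer; rewrite /= -nE.
split; first exact: ltnW.
move=> [_ [V]]; rewrite nbhsE => -[W [+ Wx] WV] VE; rewrite open_layersE => oW.
have [c cx cW] := oW x Wx (leq_ltn_trans (leq0n n) nx).
have [Px clx] := layerP x.
have [b [clb cb bx]] := cof_class_between clx nx cx.
have [y yb ly] := layers_mem (Pdown (ltnW nx) Px) clb.
have yx : y <> x by move=> yx; move: bx; rewrite -yb yx ltxx.
apply: yx; suff : [set x] y by [].
by rewrite -VE; split; [apply/WV/cW; rewrite ?yb ?cb// ly|rewrite /= ly].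
Qed.

End Layers.

(** * Nabla products of layered spaces that are not D-spaces *)

Section NotD.
Variable P : nat -> set nat.
Hypothesis P0 : forall n, P n 0%N.
Hypothesis Pev : forall m, exists N, forall n, (N <= n)%N -> P n m.

Let X (n : nat) : topologicalType := layers (P n).
Local Notation nabla := (nabla_product X).

(** Coordinates in different spaces [X n] are compared in the common order
    [O]. *)
Definition ev_const (f : box_product X) (a : O) : Prop :=
  exists N, forall n, (N <= n)%N -> sval (f n) = a.

Lemma ev_const_inj f a b : ev_const f a -> ev_const f b -> a = b.
Proof.
move=> [M fa] [N fb].
by rewrite -(fa (maxn M N)) ?leq_maxl// (fb (maxn M N)) ?leq_maxr.
Qed.

Lemma ev_const_repr f a : ev_const (repr (\pi_nabla f)) a <-> ev_const f a.
Proof.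
have [M fE] := repr_nabla f.
by split=> -[N fa]; exists (maxn M N) => n; rewrite geq_max => /andP[/fE e /fa];
  rewrite e.
Qed.

(** The sequence constantly [a], modified on the finitely many coordinates
    whose space does not contain the class of [a]. *)
Lemma ev_const_exists n a : cof_class n a -> exists f, ev_const f a.
Proof.
move=> na; have [N PN] := Pev n.
have [b [_ b0]] := cof_class_unbounded 0 a.
have fex k : exists x : X k, P k n -> sval x = a.
   have [Pk|nPk] := pselect (P k n).
    by have [x xa _] := layers_mem Pk na; exists x.
  by have [x _ _] := layers_mem (P0 k) b0; exists x.
by exists (fun k => projT1 (cid (fex k))), N => k /PN; case: cid.
Qed.

Definition diagonal : set nabla := [set q | exists a, ev_const (repr q) a].

(** Around each coordinate of a sequence [f] take a neighborhood below it that
    lies above the neighboring coordinates of [f] that are smaller. Then the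
    neighborhoods of two consecutive distinct coordinates are disjoint. If a
    sequence in the box of these neighborhoods is eventually constant, then
    consecutive coordinates of [f] are eventually equal. *)
Lemma closed_diagonal : closed diagonal.
Proof.
rewrite -[diagonal]setCK; apply: open_closedC; rewrite openE => q ndq.
pose f := repr q.
pose avoid n m : set (X n) :=
  [set y | sval (f m) < sval (f n) -> sval (f m) < sval y].
pose W n : set (X n) :=
  [set y | sval y <= sval (f n)] `&` avoid n n.+1 `&` avoid n n.-1.
have oavoid n m : open (avoid n m).
  rewrite open_layersE => y ya y_gt0; rewrite /avoid/= in ya *.
  have [c cy _] := layers_openT (x := y) Logic.I y_gt0.
  have [mn|_] := boolP (sval (f m) < sval (f n)); last by exists c.
  (* The bound [sval (f m)] itself is below every point of the set. *)
  by exists (sval (f m)) => [|z /andP[]//]; exact: ya.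
have oW n : open (W n).
  apply: openI => //; apply: openI => //.
  by apply: open_layers_down => x y /= xf /ltW/le_trans; apply.
rewrite /interior nbhsE; exists (nabla_box W).
  split; first exact: open_nabla_box.
  by exists 0%N => n _; split; [split|] => //=.
move=> r [M Wr] [a [N ra]]; apply: ndq.
have fS n : (maxn M N <= n)%N -> sval (f n.+1) = sval (f n).
  rewrite geq_max => /andP[Mn Nn].
  have [[/= ran raS] _] := Wr n Mn.
  have [[/= raSn _] raP] := Wr n.+1 (leqW Mn).
  rewrite /avoid/= (ra _ Nn) in raS; rewrite /avoid/= (ra _ (leqW Nn)) in raP.
  rewrite (ra _ Nn) in ran; rewrite (ra _ (leqW Nn)) in raSn.
  apply/eqP; rewrite eq_le !leNgt; apply/andP; split; apply/negP.
    by move=> /raP; rewrite ltNge ran.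
  by move=> /raS; rewrite ltNge raSn.
exists (sval (f (maxn M N))), (maxn M N) => n.
move=> /subnK<-; elim: (n - _)%N => // k IH.
by rewrite addSn fS ?leq_addl.
Qed.

Definition initial_net (q : nabla) : set nabla :=
  if pselect (exists a, ev_const (repr q) a) is left h
  then nabla_box (fun n => [set y : X n | sval y <= projT1 (cid h)])
  else ~` diagonal.

Lemma initial_net_neighbornet : neighbornet initial_net.
Proof.
move=> q; rewrite /initial_net; case: pselect => [h|//]; last first.
  by split=> //; apply: closed_openC; exact: closed_diagonal.
case: cid => a [N qa] /=; split.
  apply: open_nabla_box => n; apply: open_layers_down => x y /= xa /ltW/le_trans.
  exact.
by exists N => n /qa /= ->.
Qed.

Lemma initial_net_diagonal (q : nabla) (f : box_product X) a :
  ev_const f a -> initial_net q (\pi_nabla f) ->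
  exists2 b, ev_const (repr q) b & a <= b.
Proof.
move=> fa; rewrite /initial_net; case: pselect => [h|_]; last first.
  by case; exists a; apply/ev_const_repr.
case: cid => b qb /= /nabla_box_pi[M fb]; exists b => //.
have [N fN] := fa.
by rewrite -(fN (maxn M N)) ?leq_maxr//; apply: fb; rewrite leq_maxl.
Qed.

Definition trace (D : set nabla) (n : nat) : set O :=
  [set a | cof_class n a /\ exists2 q, D q & ev_const (repr q) a].

(** An unbounded trace contains a climb with supremum [b] of class [n.+1]. A
    box around the sequence constantly [b] gives countably many bounds below
    [b], one for each coordinate. They have a common bound
    [e] below [b], and the climb passes [e]: there is an element of [D] that is
    constantly a point of class [n] between [e] and [b], hence in the box. *)
Lemma trace_limit_point (D : set nabla) (n : nat) :
  (forall c, exists2 a, trace D n a & c < a) ->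
  exists q, limit_point D q.
Proof.
move=> unbD.
have cD : directed (towers n.+1) (trace D n).
  move=> g _; have [//|c _ gc] := bounded (f := g).
  have [a Da ca] := unbD c; exists a => // i; exact: lt_trans (gc i) ca.
have [|b [d [clb dD cofd]]] := cof_class_limit _ cD.
  by have [a Da _] := unbD o0; exists a.
have [f fb] := ev_const_exists clb; exists (\pi_nabla f) => A /nbhs_nabla_box.
move=> [W [oW Wf WA]]; have [N fN] := fb.
have /choice[c cP] : forall k, exists c, c < b /\ ((N <= k)%N ->
    forall y : X k, c < sval y < b -> (layer y < n.+1)%N -> W k y).
  move=> k; have [Nk|Nk] := leqP N k; last first.
    by exists (d (towers0 _)); split=> //; have [] := dD (towers0 n.+2).
  have lf : layer (f k) = n.+1.
    by have [_] := layerP (f k); rewrite fN// => /cof_class_inj; apply.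
  have := oW k; rewrite open_layersE => /(_ _ (Wf k)); rewrite lf fN//.
  by move=> /(_ isT)[c cb cW]; exists c.
have [|e eb ce] := directed_le (leq0n n.+1) clb.1 (f := c).
  by move=> k; have [] := cP k.
have [w ew] := cofd e eb; have [[clw [q Dq qw]] wb] := dD w.
exists q; split=> //; last first.
  apply: WA; have [M qM] := qw; exists (maxn M N) => k; rewrite geq_max => /andP[Mk Nk].
  have [_ +] := cP k; apply=> //.
    by rewrite qM// wb andbT; exact: lt_trans (ce k) ew.
  have [_] := layerP (repr q k); rewrite qM// => /cof_class_inj/(_ clw) ->.
  exact: ltnSn.
apply/eqP => qf; move: qw; rewrite qf => /ev_const_repr/(ev_const_inj fb) bw.
by move: wb; rewrite -bw ltxx.
Qed.

(** With all traces bounded, let [e] bound the countably many bounds and let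
    [a] be a point of class 0 above [e]. The sequence constantly [a] can only
    be covered by the neighborhood of an eventually constant sequence in [D],
    which consists of sequences eventually bounded by [e]. *)
Lemma nabla_layers_not_D : ~ D_space nabla.
Proof.
move=> /(_ _ initial_net_neighbornet)[D [clD disD covD]].
have /choice[c Dc] : forall n, exists c, forall a, trace D n a -> a <= c.
  move=> n; apply: contrapT => /forallNP nb.
  have [|q Dq] := @trace_limit_point D n.
    move=> c; have /existsNP[a /not_implyP[Da /negP]] := nb c.
    by rewrite -ltNge; exists a.
  have : closure D q by rewrite closure_isolated_limit_point; right.
  move=> /clD/disD isoq.
  by have /disj_setPS/(_ q) := disjoint_isolated_limit_point D; apply.
have [//|e _ ce] := bounded (n := 0) (f := c).
have [a [ea a0]] := cof_class_unbounded 0 e.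
have [f fa] := ev_const_exists a0.
have : [set: nabla] (\pi_nabla f) by [].
rewrite -covD => -[q Dq /(initial_net_diagonal fa)[b qb ab]].
have [m mb] : exists m, cof_class m b.
  have [N qN] := qb; exists (layer (repr q N)).
  by rewrite -(qN N)//; have [] := layerP (repr q N).
have bc : b <= c m by apply: Dc; split=> //; exists q.
have := le_lt_trans ab (le_lt_trans bc (lt_trans (ce m) ea)).
by rewrite ltxx.
Qed.

End NotD.

End LongOrder.

(** * The two examples *)

(** The disjoint union of all towers serves as the index type of [wide_order]:
    a family over one tower extends to it by a default value. *)
Lemma tower_order : exists O : orderType (Order.Disp tt tt), [/\ inhabited O,
  (forall n, directed (towers n) [set: O]) &
  (forall n (f : towers n -> O), exists b, (forall i, f i <= b) /\
     forall c, (forall i, f i <= c) -> b <= c)].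
Proof.
have [O [[o0] bndO lubO]] := @wide_order {n & towers n} (Tagged towers (towers0 0)).
exists O; split=> [//|n f|n f].
  move=> _; have [b fb] := bndO (fun u => f (tagged_as (Tagged towers (towers0 n)) u)).
  by exists b => // i; have := fb (Tagged towers i); rewrite tagged_asE.
have [b [fb lubb]] := lubO (fun u => f (tagged_as (Tagged towers (towers0 n)) u)).
exists b; split=> [i|c fc]; last by apply: lubb => u; exact: fc.
by have := fb (Tagged towers i); rewrite tagged_asE.
Qed.

Theorem mainTheorem6 :
  (exists X : topologicalType,
     [/\ scattered X,
         countable_scattered_height X &
         ~ D_space (nabla_product (fun _ : nat => X))])
  /\
  (exists X : nat -> topologicalType,
     (forall n : nat,
        scattered (X n) /\ scattered_height (X n) (ord_nat n)) /\
     ~ D_space (nabla_product X)).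
Proof.
have [O [[o0] bnd lub]] := tower_order.
split.
  exists (layers O setT); split.
  - exact: layers_scattered.
  - exists ord_omega; last exact: countable_ord_omega.
    apply: scattered_height_omega => [n|].
      have [a [_ na]] := cof_class_unbounded bnd lub n o0.
      have [x _ xn] := layers_mem (P := setT) Logic.I na.
      by exists x; rewrite (derived_layers lub)//= xn.
    rewrite -subset0 => x /(_ (layer x).+1 Logic.I).
    by rewrite (derived_layers lub)//= ltnn.
  - apply: (nabla_layers_not_D o0 bnd lub) => // m; by exists 0%N.
exists (fun n => layers O [set m | (m <= n)%N]); split=> [n|]; last first.
  by apply: (nabla_layers_not_D o0 bnd lub) => // m; exists m.
have down k m : (k <= m)%N -> [set m | (m <= n)%N] m -> [set m | (m <= n)%N] k.
  exact: leq_trans.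
split; first exact: layers_scattered.
apply: scattered_height_nat.
  have [a [_ na]] := cof_class_unbounded bnd lub n o0.
  have [x _ xn] := layers_mem (P := [set m | (m <= n)%N]) (leqnn n) na.
  by exists x; rewrite (derived_layers lub)//= xn.
rewrite (derived_layers lub)// -subset0 => x /=.
by have [xn _] := layerP x; rewrite ltnNge xn.
Qed.
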